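(* Let $E$ be a propositional variable and $\delta$ a new atomic formula symbol (the fixed point operator of $A(p,E)=E\wedge\neg(\exists x)x:(p\rightarrow E)$). Then $\mathsf{QLP}(\delta\leftrightarrow[E\wedge\neg(\exists x)x:(\delta\rightarrow E)])_{\emptyset}\vdash\neg\delta$, where this logic is $\mathsf{QLP}$ without Axiom Necessitation, over the language extended by $\delta$, with the single additional axiom $\delta\leftrightarrow[E\wedge\neg(\exists x)x:(\delta\rightarrow E)]$.
   Context: Fix countably many justification variables, propositional variables, and primitive function symbols of each arity $n\ge0$; a primitive term is $f(x_1,\dots,x_n)$. Terms of $\mathsf{QLP}$: $t::= x\mid f(x_1,\dots,x_n)\mid t\cdot t\mid t+t\mid !t\mid(t\forall x)$ ($x$ bound in $(t\forall x)$). Formulas: $A::= p\mid\bot\mid\neg A\mid A\wedge A\mid A\vee A\mid A\rightarrow A\mid t:A\mid(\forall x)A\mid(\exists x)A$. Axioms: all propositional tautologies; Q1: $(\forall x)A(x)\rightarrow A(t)$, $t$ free for $x$; Q2: $(\forall x)(A\rightarrow B(x))\rightarrow(A\rightarrow(\forall x)B(x))$, $x$ not free in $A$; Q3: $A(t)\rightarrow(\exists x)A(x)$, $t$ free for $x$; Q4: $(\forall x)(A(x)\rightarrow B)\rightarrow((\exists x)A(x)\rightarrow B)$, $x$ not free in $B$; jK: $s:(A\rightarrow B)\rightarrow(t:A\rightarrow(s\cdot t):B)$; jT: $t:A\rightarrow A$; j4: $t:A\rightarrow !t:t:A$; Sum: $s:A\rightarrow(s+t):A$, $s:A\rightarrow(t+s):A$;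 UF: $(\exists y)y:(\forall x)t:A\rightarrow(t\forall x):(\forall x)A$, $y$ not free in $t$ or $A$. Rules: Modus Ponens; Gen: from $A$ infer $(\forall x)A$; qNec: from $A$ infer $(\exists x)x:A$, $x$ not free in $A$; Axiom Necessitation: from an axiom instance $A$ infer $f(x_1,\dots,x_n):A$. The subscript $\emptyset$ means Axiom Necessitation is dropped. All schemes and rules apply to formulas of the extended language. *)

(* Defs.v *)
From mathcomp Require Import all_boot.

Set Implicit Arguments.
Unset Strict Implicit.
Unset Printing Implicit Defensive.

Definition jvar := nat.
Definition pvar := nat.

(* Function symbols of arity n are numbered by nat. As in the grammar of QLP,
   their arguments are variables, not arbitrary terms. *)
Inductive term : Type :=
| Var (x : jvar)
| Prim (n : nat) (f : nat) (xs : n.-tuple jvar)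
| App (s t : term)
| Plus (s t : term)
| Bang (t : term)
| Uni (t : term) (x : jvar).

(* D is the type of the atomic symbols added to the language: [form void] is
   the language of QLP itself, [form unit] its extension by one symbol. *)
Inductive form (D : Type) : Type :=
| PVar (p : pvar)
| Sym (d : D)
| Bot
| Neg (A : form D)
| And (A B : form D)
| Or (A B : form D)
| Imp (A B : form D)
| Just (t : term) (A : form D)
| All (x : jvar) (A : form D)
| Ex (x : jvar) (A : form D).

Arguments PVar {D} p.
Arguments Bot {D}.

Definition Iff (D : Type) (A B : form D) : form D := And (Imp A B) (Imp B A).

Fixpoint free_in_term (x : jvar) (s : term) : bool :=
  match s with
  | Var y => x == y
  | Prim _ _ xs => x \in xs
  | App s1 s2 | Plus s1 s2 => free_in_term x s1 || free_in_term x s2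
  | Bang s1 => free_in_term x s1
  | Uni s1 y => (x != y) && free_in_term x s1
  end.

Fixpoint free_in (D : Type) (x : jvar) (A : form D) : bool :=
  match A with
  | PVar _ | Sym _ | Bot => false
  | Neg B => free_in x B
  | And B C | Or B C | Imp B C => free_in x B || free_in x C
  | Just s B => free_in_term x s || free_in x B
  | All y B | Ex y B => (x != y) && free_in x B
  end.

Fixpoint free_for_term (t : term) (x : jvar) (s : term) : bool :=
  match s with
  | Var _ | Prim _ _ _ => true
  | App s1 s2 | Plus s1 s2 => free_for_term t x s1 && free_for_term t x s2
  | Bang s1 => free_for_term t x s1
  | Uni s1 y =>
      ~~ free_in_term x s || (~~ free_in_term y t && free_for_term t x s1)
  end.

Fixpoint free_for (D : Type) (t : term) (x : jvar) (A : form D) : bool :=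
  match A with
  | PVar _ | Sym _ | Bot => true
  | Neg B => free_for t x B
  | And B C | Or B C | Imp B C => free_for t x B && free_for t x C
  | Just s B => free_for_term t x s && free_for t x B
  | All y B | Ex y B =>
      ~~ free_in x A || (~~ free_in_term y t && free_for t x B)
  end.

Definition omap2 (R S T : Type) (h : R -> S -> T) (a : option R) (b : option S)
  : option T := obind (fun u => omap (h u) b) a.

(* Substitution of t for the free occurrences of x. It is partial: replacing an
   argument of a primitive term by anything but a variable does not give a
   term. *)
Fixpoint subst_term (t : term) (x : jvar) (s : term) : option term :=
  match s with
  | Var y => Some (if y == x then t else s)
  | Prim n f xs =>
      if x \notin xs then Some s
      else if t is Var z
           then Some (Prim f (map_tuple (fun y => if y == x then z else y) xs))
           else None
  | App s1 s2 => omap2 App (subst_term t x s1) (subst_term t x s2)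
  | Plus s1 s2 => omap2 Plus (subst_term t x s1) (subst_term t x s2)
  | Bang s1 => omap Bang (subst_term t x s1)
  | Uni s1 y =>
      if y == x then Some s else omap (fun r => Uni r y) (subst_term t x s1)
  end.

Fixpoint subst (D : Type) (t : term) (x : jvar) (A : form D)
  : option (form D) :=
  match A with
  | PVar _ | Sym _ | Bot => Some A
  | Neg B => omap (@Neg D) (subst t x B)
  | And B C => omap2 (@And D) (subst t x B) (subst t x C)
  | Or B C => omap2 (@Or D) (subst t x B) (subst t x C)
  | Imp B C => omap2 (@Imp D) (subst t x B) (subst t x C)
  | Just s B => omap2 (@Just D) (subst_term t x s) (subst t x B)
  | All y B => if y == x then Some A else omap (All y) (subst t x B)
  | Ex y B => if y == x then Some A else omap (Ex y) (subst t x B)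
  end.

(* Truth-table value, where v gives the values of all formulas whose main
   symbol is not a propositional connective. *)
Fixpoint prop_eval (D : Type) (v : form D -> bool) (A : form D) : bool :=
  match A with
  | PVar _ | Sym _ | Just _ _ | All _ _ | Ex _ _ => v A
  | Bot => false
  | Neg B => ~~ prop_eval v B
  | And B C => prop_eval v B && prop_eval v C
  | Or B C => prop_eval v B || prop_eval v C
  | Imp B C => prop_eval v B ==> prop_eval v C
  end.

Definition tautology (D : Type) (A : form D) : Prop :=
  forall v : form D -> bool, prop_eval v A.

(* In Q1 and Q3, [B] is A(t). *)
Inductive QLP_axiom (D : Type) : form D -> Prop :=
| ax_taut A : tautology A -> QLP_axiom A
| ax_Q1 x t A B : free_for t x A -> subst t x A = Some B ->
    QLP_axiom (Imp (All x A) B)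
| ax_Q2 x A B : ~~ free_in x A ->
    QLP_axiom (Imp (All x (Imp A B)) (Imp A (All x B)))
| ax_Q3 x t A B : free_for t x A -> subst t x A = Some B ->
    QLP_axiom (Imp B (Ex x A))
| ax_Q4 x A B : ~~ free_in x B ->
    QLP_axiom (Imp (All x (Imp A B)) (Imp (Ex x A) B))
| ax_jK s t A B :
    QLP_axiom (Imp (Just s (Imp A B)) (Imp (Just t A) (Just (App s t) B)))
| ax_jT t A : QLP_axiom (Imp (Just t A) A)
| ax_j4 t A : QLP_axiom (Imp (Just t A) (Just (Bang t) (Just t A)))
| ax_Suml s t A : QLP_axiom (Imp (Just s A) (Just (Plus s t) A))
| ax_Sumr s t A : QLP_axiom (Imp (Just s A) (Just (Plus t s) A))
| ax_UF x y t A : ~~ free_in_term y t -> ~~ free_in y A ->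
    QLP_axiom (Imp (Ex y (Just (Var y) (All x (Just t A))))
                   (Just (Uni t x) (All x A))).

(* Theorems of QLP(F) with the empty subscript: F is one further axiom, and
   there is no Axiom Necessitation rule. *)
Inductive QLP_empty (D : Type) (F : form D) : form D -> Prop :=
| th_axiom A : QLP_axiom A -> QLP_empty F A
| th_extra : QLP_empty F F
| th_MP A B : QLP_empty F (Imp A B) -> QLP_empty F A -> QLP_empty F B
| th_Gen x A : QLP_empty F A -> QLP_empty F (All x A)
| th_qNec x A : ~~ free_in x A -> QLP_empty F A ->
    QLP_empty F (Ex x (Just (Var x) A)).

Definition delta : form unit := Sym tt.

(* Main.v *)
(* The axiom makes delta imply E; by qNec this implication is known, i.e.
   (∃x)x:(delta -> E), which contradicts the second conjunct of delta. *)
Require Import Defs.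
From mathcomp Require Import all_boot.

(** Propositional logic draws delta -> E from the fixed point axiom; one qNec turns this theorem
    into the justification claim that delta denies, so delta is refuted. *)

Lemma th_taut_MP (D : Type) (F A B : form D) :
  tautology (Imp A B) -> QLP_empty F A -> QLP_empty F B.
Proof. by move=> tAB; apply: th_MP; apply/th_axiom/ax_taut. Qed.

Theorem theorem27 (E : pvar) (x : jvar) :
  QLP_empty
    (Iff delta (And (PVar E) (Neg (Ex x (Just (Var x) (Imp delta (PVar E)))))))
    (Neg delta).
Proof.
set K := Ex x _; set F := Iff _ _.
have FdE : tautology (Imp F (Imp delta (PVar E))).
  by move=> v /=; case: (v delta); case: (v (PVar E)); rewrite ?implybT ?andbF.
have thK : QLP_empty F K.
  (* The side condition of qNec holds by computation: delta and E are atomic, so [x] is not free in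
     delta -> E. *)
  by apply: th_qNec => //; apply: th_taut_MP FdE (th_extra F).
have FKd : tautology (Imp F (Imp K (Neg delta))).
  move=> v /=.
  (* [prop_eval] treats [K] as an atom, so eight truth-table rows suffice. *)
  by case: (v delta); case: (v (PVar E)); case: (v (Ex _ _)).
exact: th_MP (th_taut_MP _ _ _ _ FKd (th_extra F)) thK.
Qed.
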